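(* Let $\mathcal{V}$ be a commutative unital quantale and $\mathcal{T}$ a $\mathcal{V}$-theory over a monoidal signature $\Sigma$. For every $\mathcal{V}$-implication $\Gamma\Rightarrow\phi$ over $\Sigma$, we have $\Gamma\vdash^{\mathcal{T}}\phi$ if and only if $\Gamma\Rightarrow\phi$ is satisfied by every model of $\mathcal{T}$ (every $\mathcal{V}\mathbf{Rel}$-SMC $\mathcal{C}$ equipped with a symmetric monoidal functor $\mathbf{Term}(\Sigma)\to\mathcal{C}$ satisfying all axioms of $\mathcal{T}$).
   Context: A quantale $\mathcal{V}$ is a complete lattice $(\mathcal{V},\sqsubseteq)$ with an associative binary operation $+$ preserving arbitrary suprema in each argument; we assume it is unital (has a neutral element for $+$) and commutative. A $\mathcal{V}$-relation is a set $X$ with a function $d : X\times X\to\mathcal{V}$. A $\mathcal{V}\mathbf{Rel}$-SMC is a symmetric strict monoidal category $\mathcal{C}$ with a $\mathcal{V}$-relation $d^{\mathcal{C}}$ on each hom-set such that $d^{\mathcal{C}}(f;g, f';g') \sqsupseteq d^{\mathcal{C}}(f,f') + d^{\mathcal{C}}(g,g')$ and $d^{\mathcal{C}}(f\otimes g, f'\otimes g') \sqsupseteq d^{\mathcal{C}}(f,f') + d^{\mathcal{C}}(g,g')$ whenever defined. A monoidal signature $\Sigma$ consists of a set of sorts and a set of generators, each with a list of input sorts and a list of output sorts. $\mathbf{Term}(\Sigma)$ is the free symmetric strict monoidal category on $\Sigma$: morphisms $u\to v$ are terms built from generators, identities, symmetries, the identity on the empty list, sequential composition $f;g$ and parallel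 composition $f\otimes g$, modulo the laws of symmetric strict monoidal categories. An equation is $f=g$ and a $\mathcal{V}$-equation is $f=_\varepsilon g$ ($\varepsilon\in\mathcal{V}$), for terms $f,g$ of the same type. A $\mathcal{V}$-implication $\Gamma\Rightarrow\phi$ consists of a set $\Gamma$ of (quantitative) equations (premises) and a (quantitative) equation $\phi$ (conclusion). A $\mathcal{V}$-theory $\mathcal{T}$ is a signature with a set of $\mathcal{V}$-implications (axioms). Given a symmetric monoidal functor $\llbracket-\rrbracket:\mathbf{Term}(\Sigma)\to\mathcal{C}$ into a $\mathcal{V}\mathbf{Rel}$-SMC: $f=g$ is satisfied if $\llbracket f\rrbracket=\llbracket g\rrbracket$; $f=_\varepsilon g$ is satisfied if $d^{\mathcal{C}}(\llbracket f\rrbracket,\llbracket g\rrbracket)\sqsupseteq\varepsilon$; $\Gamma\Rightarrow\phi$ is satisfied if $\phi$ is satisfied or some premise in $\Gamma$ is not. The closure $\vdash^{\mathcal{T}}$ is the smallest consequence relation (i.e.\ set of implications $\Gamma\vdash\phi$ closed under: $\phi\in\Gamma$ implies $\Gamma\vdash\phi$; weakening of premises; and cut: if $\Gamma\vdash\psi$ for all $\psi\in\Delta$ and $\Delta\cup\Delta'\vdash\chi$ then $\Gamma\cup\Delta'\vdash\chi$) containing the axioms of $\mathcal{T}$ and the following implications for all terms and elements of $\mathcal{V}$: $f=_\varepsilon g\Rightarrow f=_{\varepsilon'} g$ when $\varepsilon\sqsupseteq\varepsilon'$; $\{f=_{\varepsilon_i}g\}_{i\in I}\Rightarrow f=_{\bigsqcup_i\varepsilon_i}g$;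 $f=_\varepsilon f', g=_\delta g' \Rightarrow f;g=_{\varepsilon+\delta} f';g'$ and $\Rightarrow f\otimes g=_{\varepsilon+\delta}f'\otimes g'$; reflexivity, symmetry, transitivity of $=$, congruence of $=$ with respect to $;$ and $\otimes$, and $f=f', f=_\varepsilon g\Rightarrow f'=_\varepsilon g$, $g=g', f=_\varepsilon g\Rightarrow f=_\varepsilon g'$; and the laws of symmetric strict monoidal categories as premise-free equations. *)

(* Defs.v *)
From HB Require Import structures.
From mathcomp Require Import all_boot all_order.
From mathcomp Require Import boolp classical_sets.

Set Implicit Arguments.
Unset Strict Implicit.
Unset Printing Implicit Defensive.

Local Open Scope classical_set_scope.
Local Open Scope quotient_scope.

(* The order ⊑ is [<=%O]; by [qaddC], preservation of suprema in the first
   argument is implied by [qadd_sup]. *)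
HB.mixin Record isQuantale (d : Order.disp_t) V of Order.POrder d V := {
  qsup : set V -> V;
  qzero : V;
  qadd : V -> V -> V;
  qsup_supremum : forall A : set V, supremums A (qsup A);
  qaddA : associative qadd;
  qaddC : commutative qadd;
  qadd0 : left_id qzero qadd;
  qadd_sup : forall (x : V) (A : set V),
    qadd x (qsup A) = qsup [set qadd x y | y in A]
}.

#[short(type="quantaleType")]
HB.structure Definition Quantale (d : Order.disp_t) :=
  {V of isQuantale d V & Order.POrder d V}.

Declare Scope quantale_scope.
Delimit Scope quantale_scope with V.
Notation "x + y" := (qadd x y) : quantale_scope.

Definition vrelation d (V : quantaleType d) (X : Type) := X -> X -> V.

(* Objects of a strict monoidal category satisfy associativity and unitality
   as equalities; [castm] transports a morphism along equalities of its
   endpoints, so that the laws for the tensor of morphisms are well typed. *)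
Definition castm (O : Type) (H : O -> O -> Type) (a a' b b' : O)
    (ea : a = a') (eb : b = b') (f : H a b) : H a' b' :=
  ecast x (H x b') ea (ecast y (H a y) eb f).

Reserved Notation "f ;; g" (at level 48, left associativity).
Reserved Notation "f ⊗ g" (at level 44, left associativity).
Reserved Notation "a ⊙ b" (at level 44, left associativity).

(* [⊙] is the tensor of objects, [⊗] the tensor of morphisms, and [;;]
   composition in diagrammatic order. *)
Record ssmc := SSMC {
  ob :> Type;
  hom : ob -> ob -> Type;
  unito : ob;
  tenso : ob -> ob -> ob where "a ⊙ b" := (tenso a b);
  tensoA : associative tenso;
  tens1o : left_id unito tenso;
  tenso1 : right_id unito tenso;
  idm : forall a, hom a a;
  compm : forall a b c, hom a b -> hom b c -> hom a c
    where "f ;; g" := (compm f g);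
  tensm : forall a b a' b', hom a b -> hom a' b' -> hom (a ⊙ a') (b ⊙ b')
    where "f ⊗ g" := (tensm f g);
  symm : forall a b, hom (a ⊙ b) (b ⊙ a);
  compmA : forall a b c d (f : hom a b) (g : hom b c) (h : hom c d),
    f ;; (g ;; h) = (f ;; g) ;; h;
  comp1m : forall a b (f : hom a b), idm a ;; f = f;
  compm1 : forall a b (f : hom a b), f ;; idm b = f;
  tensmA : forall a a' b b' c c' (f : hom a a') (g : hom b b') (h : hom c c'),
    castm (tensoA a b c) (tensoA a' b' c') (f ⊗ (g ⊗ h)) = (f ⊗ g) ⊗ h;
  tens1m : forall a b (f : hom a b),
    castm (tens1o a) (tens1o b) (idm unito ⊗ f) = f;
  tensm1 : forall a b (f : hom a b),
    castm (tenso1 a) (tenso1 b) (f ⊗ idm unito) = f;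
  tensm_id : forall a b, idm a ⊗ idm b = idm (a ⊙ b);
  tensm_comp : forall a b c a' b' c' (f : hom a b) (g : hom b c)
      (f' : hom a' b') (g' : hom b' c'),
    (f ;; g) ⊗ (f' ;; g') = (f ⊗ f') ;; (g ⊗ g');
  symm_nat : forall a b a' b' (f : hom a b) (f' : hom a' b'),
    (f ⊗ f') ;; symm b b' = symm a a' ;; (f' ⊗ f);
  symmK : forall a b, symm a b ;; symm b a = idm (a ⊙ b);
  symm_unit : forall a, castm (tenso1 a) (tens1o a) (symm a unito) = idm a;
  symm_hexagon : forall a b c,
    castm (tensoA a b c) (esym (tensoA b c a)) (symm a (b ⊙ c)) =
    castm erefl (esym (tensoA b a c)) (symm a b ⊗ idm c) ;; (idm b ⊗ symm a c)
}.

(* Preservation of tensors holds on the nose: functors are strict, as the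
   universal property of the free symmetric strict monoidal category requires. *)
Record ssm_functor (C D : ssmc) := SSMFunctor {
  fob :> C -> D;
  fob_unit : fob (unito C) = unito D;
  fob_tens : forall a b : C, fob (tenso a b) = tenso (fob a) (fob b);
  fmor : forall a b : C, hom a b -> hom (fob a) (fob b);
  fmor_id : forall a : C, fmor (idm a) = idm (fob a);
  fmor_comp : forall (a b c : C) (f : hom a b) (g : hom b c),
    fmor (compm f g) = compm (fmor f) (fmor g);
  fmor_tens : forall (a b a' b' : C) (f : hom a b) (g : hom a' b'),
    castm (fob_tens a a') (fob_tens b b') (fmor (tensm f g)) =
    tensm (fmor f) (fmor g);
  fmor_symm : forall a b : C,
    castm (fob_tens a b) (fob_tens b a) (fmor (symm a b)) =
    symm (fob a) (fob b)
}.

Record vrel_smc d (V : quantaleType d) := VRelSMC {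
  smc_of :> ssmc;
  dist : forall a b : smc_of, vrelation V (hom a b);
  dist_comp : forall (a b c : smc_of) (f f' : hom a b) (g g' : hom b c),
    (dist f f' + dist g g' <= dist (compm f g) (compm f' g'))%V%O;
  dist_tens : forall (a b a' b' : smc_of) (f f' : hom a b) (g g' : hom a' b'),
    (dist f f' + dist g g' <= dist (tensm f g) (tensm f' g'))%V%O
}.

Record signature := Signature {
  sorts : Type;
  gen : Type;
  ins : gen -> seq sorts;
  outs : gen -> seq sorts
}.

(* The identity on the empty list is [Id [::]]. *)
Inductive term (S : signature) : seq (sorts S) -> seq (sorts S) -> Type :=
| Gen (g : gen S) : term (ins g) (outs g)
| Id (u : seq (sorts S)) : term u u
| Sym (u v : seq (sorts S)) : term (u ++ v) (v ++ u)
| Seq u v w (f : term u v) (g : term v w) : term u w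
| Par u v u' v' (f : term u v) (g : term u' v') : term (u ++ u') (v ++ v').

Notation "f ;; g" := (Seq f g) : term_scope.
Notation "f ⊗ g" := (Par f g) : term_scope.
Local Open Scope term_scope.

Inductive smc_law (S : signature) :
    forall u v : seq (sorts S), term u v -> term u v -> Prop :=
| LSeqA u v w x (f : term u v) (g : term v w) (h : term w x) :
    smc_law (f ;; (g ;; h)) ((f ;; g) ;; h)
| LSeq1t u v (f : term u v) : smc_law (Id u ;; f) f
| LSeqt1 u v (f : term u v) : smc_law (f ;; Id v) f
| LParA u u' v v' w w' (f : term u u') (g : term v v') (h : term w w') :
    smc_law (castm (catA u v w) (catA u' v' w') (f ⊗ (g ⊗ h))) ((f ⊗ g) ⊗ h)
| LPar1t u v (f : term u v) :
    smc_law (castm (cat0s u) (cat0s v) (Id [::] ⊗ f)) f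
| LPart1 u v (f : term u v) :
    smc_law (castm (cats0 u) (cats0 v) (f ⊗ Id [::])) f
| LParId u v : smc_law (Id u ⊗ Id v) (Id (u ++ v))
| LParSeq u v w u' v' w' (f : term u v) (g : term v w)
      (f' : term u' v') (g' : term v' w') :
    smc_law ((f ;; g) ⊗ (f' ;; g')) ((f ⊗ f') ;; (g ⊗ g'))
| LSymNat u v u' v' (f : term u v) (f' : term u' v') :
    smc_law ((f ⊗ f') ;; Sym v v') (Sym u u' ;; (f' ⊗ f))
| LSymK (u v : seq (sorts S)) : smc_law (Sym u v ;; Sym v u) (Id (u ++ v))
| LSymUnit (u : seq (sorts S)) :
    smc_law (castm (cats0 u) (cat0s u) (Sym u [::])) (Id u)
| LSymHexagon (u v w : seq (sorts S)) :
    smc_law (castm (catA u v w) (esym (catA v w u)) (Sym u (v ++ w)))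
      (castm erefl (esym (catA v u w)) (Sym u v ⊗ Id w) ;; (Id v ⊗ Sym u w)).

Record congruence (S : signature) := Congruence {
  cong_rel : forall u v : seq (sorts S), term u v -> term u v -> Prop;
  cong_refl : forall u v (f : term u v), cong_rel f f;
  cong_sym : forall u v (f g : term u v), cong_rel f g -> cong_rel g f;
  cong_trans : forall u v (f g h : term u v),
    cong_rel f g -> cong_rel g h -> cong_rel f h;
  cong_seq : forall u v w (f f' : term u v) (g g' : term v w),
    cong_rel f f' -> cong_rel g g' -> cong_rel (f ;; g) (f' ;; g');
  cong_par : forall u v u' v' (f f' : term u v) (g g' : term u' v'),
    cong_rel f f' -> cong_rel g g' -> cong_rel (f ⊗ g) (f' ⊗ g');
  cong_law : forall u v (f g : term u v), smc_law f g -> cong_rel f g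
}.

Section Quotient.
Variables (S : signature) (R : congruence S).
Implicit Types u v w : seq (sorts S).

Definition cong_relb u v (f g : {classic term u v}) : bool := `[< cong_rel R f g >].

Lemma cong_relb_refl u v : reflexive (@cong_relb u v).
Proof. by move=> f; apply/asboolP; exact: cong_refl. Qed.

Lemma cong_relb_sym u v : symmetric (@cong_relb u v).
Proof.
by move=> f g; apply/idP/idP => /asboolP fg; apply/asboolP; exact: cong_sym.
Qed.

Lemma cong_relb_trans u v : transitive (@cong_relb u v).
Proof.
move=> g f h /asboolP fg /asboolP gh; apply/asboolP; exact: cong_trans fg gh.
Qed.

Definition cong_equiv u v : equiv_rel {classic term u v} :=
  EquivRel (@cong_relb u v)
    (@cong_relb_refl u v) (@cong_relb_sym u v) (@cong_relb_trans u v).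

Definition qhom u v : Type := {eq_quot (cong_equiv u v)}.

Definition qclass u v (f : term u v) : qhom u v :=
  \pi_({eq_quot (cong_equiv u v)}) (f : {classic term u v}).

Definition qrepr u v (x : qhom u v) : term u v :=
  repr (x : {eq_quot (cong_equiv u v)}).

Lemma qreprK u v (x : qhom u v) : qclass (qrepr x) = x.
Proof. exact: reprK. Qed.

Lemma qclassP u v (f g : term u v) : qclass f = qclass g <-> cong_rel R f g.
Proof. by split=> [/eqmodP/asboolP | fg]; [|apply/eqmodP/asboolP]. Qed.

Lemma qrepr_class u v (f : term u v) : cong_rel R (qrepr (qclass f)) f.
Proof. by apply/qclassP; rewrite qreprK. Qed.

Definition qseq u v w (x : qhom u v) (y : qhom v w) : qhom u w :=
  qclass (qrepr x ;; qrepr y).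

Definition qpar u v u' v' (x : qhom u v) (y : qhom u' v') :
    qhom (u ++ u') (v ++ v') :=
  qclass (qrepr x ⊗ qrepr y).

Lemma qseqE u v w (f : term u v) (g : term v w) :
  qseq (qclass f) (qclass g) = qclass (f ;; g).
Proof. by apply/qclassP; apply: cong_seq; exact: qrepr_class. Qed.

Lemma qparE u v u' v' (f : term u v) (g : term u' v') :
  qpar (qclass f) (qclass g) = qclass (f ⊗ g).
Proof. by apply/qclassP; apply: cong_par; exact: qrepr_class. Qed.

Lemma qclass_cast u u' v v' (eu : u = u') (ev : v = v') (f : term u v) :
  qclass (castm eu ev f) = castm eu ev (qclass f).
Proof. by case: u' / eu; case: v' / ev. Qed.

Lemma qhomW u v (P : qhom u v -> Prop) :
  (forall f, P (qclass f)) -> forall x, P x.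
Proof. by move=> Pf x; rewrite -(qreprK x). Qed.

Definition qsmc : ssmc.
Proof.
refine (@SSMC (seq (sorts S)) qhom [::] cat (@catA _) (@cat0s _) (@cats0 _)
  (fun u => qclass (Id u)) qseq qpar (fun u v => qclass (Sym u v))
  _ _ _ _ _ _ _ _ _ _ _ _).
- move=> u v w x; elim/qhomW=> f; elim/qhomW=> g; elim/qhomW=> h.
  by rewrite !qseqE; apply/qclassP/cong_law; constructor.
- move=> u v; elim/qhomW=> f.
  by rewrite qseqE; apply/qclassP/cong_law; constructor.
- move=> u v; elim/qhomW=> f.
  by rewrite qseqE; apply/qclassP/cong_law; constructor.
- move=> u u' v v' w w'; elim/qhomW=> f; elim/qhomW=> g; elim/qhomW=> h.
  by rewrite !qparE -qclass_cast; apply/qclassP/cong_law; constructor.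
- move=> u v; elim/qhomW=> f.
  by rewrite qparE -qclass_cast; apply/qclassP/cong_law; constructor.
- move=> u v; elim/qhomW=> f.
  by rewrite qparE -qclass_cast; apply/qclassP/cong_law; constructor.
- by move=> u v; rewrite qparE; apply/qclassP/cong_law; constructor.
- move=> u v w u' v' w'.
  elim/qhomW=> f; elim/qhomW=> g; elim/qhomW=> f'; elim/qhomW=> g'.
  by rewrite !(qseqE, qparE); apply/qclassP/cong_law; constructor.
- move=> u v u' v'; elim/qhomW=> f; elim/qhomW=> f'.
  by rewrite !(qseqE, qparE); apply/qclassP/cong_law; constructor.
- by move=> u v; rewrite qseqE; apply/qclassP/cong_law; constructor.
- by move=> u; rewrite -qclass_cast; apply/qclassP/cong_law; constructor.
- move=> u v w; rewrite !qparE -!qclass_cast qseqE.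
  by apply/qclassP/cong_law; constructor.
Defined.

End Quotient.

Inductive smc_eq (S : signature) :
    forall u v : seq (sorts S), term u v -> term u v -> Prop :=
| SELaw u v (f g : term u v) : smc_law f g -> smc_eq f g
| SERefl u v (f : term u v) : smc_eq f f
| SESym u v (f g : term u v) : smc_eq f g -> smc_eq g f
| SETrans u v (f g h : term u v) : smc_eq f g -> smc_eq g h -> smc_eq f h
| SESeq u v w (f f' : term u v) (g g' : term v w) :
    smc_eq f f' -> smc_eq g g' -> smc_eq (f ;; g) (f' ;; g')
| SEPar u v u' v' (f f' : term u v) (g g' : term u' v') :
    smc_eq f f' -> smc_eq g g' -> smc_eq (f ⊗ g) (f' ⊗ g').

Definition smc_congruence (S : signature) : congruence S :=
  Congruence (@SERefl S) (@SESym S) (@SETrans S) (@SESeq S) (@SEPar S)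
    (@SELaw S).

Definition Term (S : signature) : ssmc := qsmc (smc_congruence S).

Definition mor_of_term (S : signature) (u v : seq (sorts S)) (f : term u v) :
    @hom (Term S) u v :=
  qclass (smc_congruence S) f.

Inductive formula d (V : quantaleType d) (S : signature) : Type :=
| Eqn (u v : seq (sorts S)) (f g : term u v)
| VEqn (u v : seq (sorts S)) (e : V) (f g : term u v).

Arguments Eqn {d V S u v} f g.
Arguments VEqn {d V S u v} e f g.

Record implication d (V : quantaleType d) (S : signature) := Implication {
  premises : set (formula V S);
  conclusion : formula V S
}.

Notation "G ⇒ phi" := (Implication G phi) (at level 90, no associativity).

Definition theory d (V : quantaleType d) (S : signature) :=
  set (implication V S).

Section Satisfaction.
Context d (V : quantaleType d) (S : signature).
Variables (C : vrel_smc V) (F : ssm_functor (Term S) C).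

Definition interp (u v : seq (sorts S)) (f : term u v) : hom (F u) (F v) :=
  fmor F (mor_of_term f).

Definition sat (phi : formula V S) : Prop :=
  match phi with
  | Eqn _ _ f g => interp f = interp g
  | VEqn _ _ e f g => (e <= dist (interp f) (interp g))%O
  end.

Definition sat_implication (i : implication V S) : Prop :=
  sat (conclusion i) \/ exists2 psi, premises i psi & ~ sat psi.

End Satisfaction.

Record model d (V : quantaleType d) (S : signature) (T : theory V S) := Model {
  model_cat : vrel_smc V;
  model_fun : ssm_functor (Term S) model_cat;
  model_sat : forall i, T i -> sat_implication model_fun i
}.

Section Closure.
Context d (V : quantaleType d) (S : signature).

Definition consequence_relation (R : set (implication V S)) : Prop :=
  [/\ forall (G : set (formula V S)) phi, G phi -> R (G ⇒ phi),
      forall (G G' : set (formula V S)) phi,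
        G `<=` G' -> R (G ⇒ phi) -> R (G' ⇒ phi) &
      forall (G D D' : set (formula V S)) chi,
        (forall psi, D psi -> R (G ⇒ psi)) ->
        R (D `|` D' ⇒ chi) -> R (G `|` D' ⇒ chi)].

Inductive basic_implication : set (implication V S) :=
| BWeak u v (f g : term u v) (e e' : V) : (e' <= e)%O ->
    basic_implication ([set VEqn e f g] ⇒ VEqn e' f g)
| BSup u v (f g : term u v) (I : Type) (e : I -> V) :
    basic_implication
      ([set VEqn (e i) f g | i in [set: I]] ⇒ VEqn (qsup (range e)) f g)
| BVSeq u v w (f f' : term u v) (g g' : term v w) (e d' : V) :
    basic_implication
      ([set VEqn e f f'; VEqn d' g g'] ⇒ VEqn (e + d')%V (f ;; g) (f' ;; g'))
| BVPar u v u' v' (f f' : term u v) (g g' : term u' v') (e d' : V) :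
    basic_implication
      ([set VEqn e f f'; VEqn d' g g'] ⇒ VEqn (e + d')%V (f ⊗ g) (f' ⊗ g'))
| BRefl u v (f : term u v) : basic_implication (set0 ⇒ Eqn f f)
| BSym u v (f g : term u v) : basic_implication ([set Eqn f g] ⇒ Eqn g f)
| BTrans u v (f g h : term u v) :
    basic_implication ([set Eqn f g; Eqn g h] ⇒ Eqn f h)
| BSeq u v w (f f' : term u v) (g g' : term v w) :
    basic_implication ([set Eqn f f'; Eqn g g'] ⇒ Eqn (f ;; g) (f' ;; g'))
| BPar u v u' v' (f f' : term u v) (g g' : term u' v') :
    basic_implication ([set Eqn f f'; Eqn g g'] ⇒ Eqn (f ⊗ g) (f' ⊗ g'))
| BEqL u v (f f' g : term u v) (e : V) :
    basic_implication ([set Eqn f f'; VEqn e f g] ⇒ VEqn e f' g)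
| BEqR u v (f g g' : term u v) (e : V) :
    basic_implication ([set Eqn g g'; VEqn e f g] ⇒ VEqn e f g')
| BLaw u v (f g : term u v) :
    smc_law f g -> basic_implication (set0 ⇒ Eqn f g).

Definition theory_closure (T : theory V S) : set (implication V S) :=
  smallest consequence_relation (T `|` basic_implication).

Definition entails (T : theory V S) (G : set (formula V S))
    (phi : formula V S) : Prop :=
  theory_closure T (G ⇒ phi).

End Closure.

Arguments basic_implication {d V S}.

(* Main.v *)
(* Soundness: the implications satisfied by a fixed model form a consequence
   relation that contains the axioms and the basic implications.
   Completeness: fix the premises G.  Quotienting terms by provable equality
   from G, with the distance of two classes being the supremum of all e such
   that [f =_e g] is provable from G, yields a model in which a formula is
   satisfied exactly when it is provable from G. *)
Require Import Defs.
From mathcomp Require Import all_boot all_order.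
From mathcomp Require Import boolp classical_sets.

Set Implicit Arguments.
Unset Strict Implicit.
Unset Printing Implicit Defensive.

Import Order.TTheory.
Local Open Scope classical_set_scope.
Local Open Scope term_scope.

Section QuantaleSup.
Context d (V : quantaleType d).
Implicit Types (A : set V) (x : V).

Lemma qsup_ub A x : A x -> (x <= qsup A)%O.
Proof. by have [ub _] := qsup_supremum A; exact: ub. Qed.

Lemma qsup_le_ub A x : (forall y, A y -> (y <= x)%O) -> (qsup A <= x)%O.
Proof. by have [_ lub] := qsup_supremum A; exact: lub. Qed.

(** If [y <= z] then [z] is the supremum of [[set y; z]], so preservation of suprema makes
    [qadd x z] an upper bound of [qadd x y]. *)
Lemma qaddl_mono x : {homo qadd x : y z / (y <= z)%O}.
Proof.
move=> y z yz; have {1}-> : z = qsup [set y; z].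
  by apply/le_anti/andP; split; [exact: qsup_ub (or_intror erefl)|
    apply: qsup_le_ub => _ [->|->]].
by rewrite qadd_sup; apply: qsup_ub; exists y => //; left.
Qed.

Lemma qadd_mono (x x' y y' : V) :
  (x <= x' -> y <= y' -> qadd x y <= qadd x' y')%O.
Proof.
move=> xx' yy'; apply: le_trans (qaddl_mono x yy') _.
by rewrite ![qadd _ y']qaddC; exact: qaddl_mono.
Qed.

End QuantaleSup.

(** A functor preserves tensors only after transport along [fob_tens]. Transport is injective and
    leaves distances unchanged, so it can be inserted on both sides to bring [interp_par] into
    play. *)
Lemma castm_inj (O : Type) (H : O -> O -> Type) (a a' b b' : O)
    (ea : a = a') (eb : b = b') :
  injective (castm (H := H) ea eb).
Proof. by case: a' / ea; case: b' / eb. Qed.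

Lemma dist_castm d (V : quantaleType d) (C : vrel_smc V) (a a' b b' : C)
    (ea : a = a') (eb : b = b') (f g : hom a b) :
  dist (castm ea eb f) (castm ea eb g) = dist f g.
Proof. by case: a' / ea; case: b' / eb. Qed.

Section Soundness.
Context d (V : quantaleType d) (S : signature).
Variables (C : vrel_smc V) (F : ssm_functor (Term S) C).

Lemma interp_seq u v w (f : term u v) (g : term v w) :
  interp F (f ;; g) = compm (interp F f) (interp F g).
Proof. by rewrite /interp -fmor_comp /= qseqE. Qed.

Lemma interp_par u v u' v' (f : term u v) (g : term u' v') :
  castm (fob_tens F u u') (fob_tens F v v') (interp F (f ⊗ g)) =
  tensm (interp F f) (interp F g).
Proof. by rewrite /interp -fmor_tens /= qparE. Qed.

Lemma interp_law u v (f g : term u v) :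
  smc_law f g -> interp F f = interp F g.
Proof. by move=> fg; congr (fmor F _); apply/qclassP/SELaw. Qed.

(** Excluded middle turns the disjunctive definition into an implication: if not all premises hold,
    some premise fails. *)
Lemma sat_implicationP (i : implication V S) :
  sat_implication F i <->
  (premises i `<=` sat F -> sat F (conclusion i)).
Proof.
split=> [[//|[psi ipsi npsi] prem]|prem]; first by case: npsi; exact: prem.
have [|nsub] := pselect (premises i `<=` sat F); first by move/prem; left.
by right; apply: contrapT => /forall2NP nex; apply: nsub => psi ipsi;
  case: (nex psi) => // /contrapT.
Qed.

Lemma sat_consequence : consequence_relation (sat_implication F).
Proof.
split=> [G psi Gpsi|G G' psi GG'|G D D' chi GD] /=.
- by apply/sat_implicationP; exact.
- move=> /sat_implicationP Gpsi; apply/sat_implicationP => /= satG'.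
  by apply: Gpsi => x /GG'; exact: satG'.
- move=> /sat_implicationP DD'chi; apply/sat_implicationP => /= satGD'.
  apply: DD'chi => psi /= [Dpsi|D'psi]; last by apply: satGD'; right.
  have /sat_implicationP := GD _ Dpsi; apply => x Gx.
  by apply: satGD'; left.
Qed.

Lemma sat_basic (i : implication V S) :
  basic_implication i -> sat_implication F i.
Proof.
case=> {i} [u v f g e e' ee'|u v f g I e|u v w f f' g g' e e'
  |u v u' v' f f' g g' e e'|u v f|u v f g|u v f g h|u v w f f' g g'
  |u v u' v' f f' g g'|u v f f' g e|u v f g g' e|u v f g fg];
  apply/sat_implicationP => /= prem.
- exact: le_trans ee' (prem (VEqn e f g) erefl).
- apply: qsup_le_ub => _ [i _ <-].
  by apply: (prem (VEqn (e i) f g)); exists i.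
- have ff' := prem (VEqn e f f') (or_introl erefl).
  have gg' := prem (VEqn e' g g') (or_intror erefl).
  by rewrite !interp_seq; apply: le_trans (dist_comp _ _ _ _); exact: qadd_mono.
- have ff' := prem (VEqn e f f') (or_introl erefl).
  have gg' := prem (VEqn e' g g') (or_intror erefl).
  rewrite -(dist_castm (fob_tens F u u') (fob_tens F v v')) !interp_par.
  by apply: le_trans (dist_tens _ _ _ _); exact: qadd_mono.
- by [].
- by rewrite (prem (Eqn f g) erefl).
- rewrite (prem (Eqn f g) (or_introl erefl)).
  exact: (prem (Eqn g h) (or_intror erefl)).
- rewrite !interp_seq (prem (Eqn f f') (or_introl erefl)).
  by rewrite (prem (Eqn g g') (or_intror erefl)).
- apply: (@castm_inj _ _ _ _ _ _ (fob_tens F u u') (fob_tens F v v')).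
  rewrite !interp_par (prem (Eqn f f') (or_introl erefl)).
  by rewrite (prem (Eqn g g') (or_intror erefl)).
- rewrite -(prem (Eqn f f') (or_introl erefl)).
  exact: (prem (VEqn e f g) (or_intror erefl)).
- rewrite -(prem (Eqn g g') (or_introl erefl)).
  exact: (prem (VEqn e f g) (or_intror erefl)).
- exact: interp_law.
Qed.

End Soundness.

Section Completeness.
Context d (V : quantaleType d) (S : signature).
Variables (T : theory V S) (G : set (formula V S)).

Lemma entails_premise phi : G phi -> entails T G phi.
Proof. by move=> Gphi R [[+ _ _] _]; exact. Qed.

(** Cut with an empty side context, [G] being read as its union with [set0]. All later derivations
    from [G] go through this form of cut. *)
Lemma entails_rule (D : set (formula V S)) (phi : formula V S) :
  (T `|` basic_implication) (D ⇒ phi) -> D `<=` entails T G -> entails T G phi.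
Proof.
move=> TDphi GD R [[Rprem Rweak Rcut] TR].
rewrite -[G]setU0; apply: (Rcut _ D) => [psi /GD GT|].
  exact: GT (conj (And3 Rprem Rweak Rcut) TR).
by rewrite setU0; exact: TR.
Qed.

Lemma entails_basic0 phi :
  basic_implication (set0 ⇒ phi) -> entails T G phi.
Proof. by move=> b; apply: (entails_rule (D := set0)) => //; right. Qed.

Lemma entails_basic1 psi phi :
  basic_implication ([set psi] ⇒ phi) -> entails T G psi -> entails T G phi.
Proof.
by move=> b Gpsi; apply: (entails_rule (D := [set psi])) => [|_ ->//]; right.
Qed.

Lemma entails_basic2 psi chi phi :
  basic_implication ([set psi; chi] ⇒ phi) ->
  entails T G psi -> entails T G chi -> entails T G phi.
Proof.
move=> b Gpsi Gchi; apply: (entails_rule (D := [set psi; chi])); first by right.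
by move=> _ [->|->].
Qed.

Definition entailed_congruence : congruence S.
Proof.
refine (@Congruence S (fun u v f g => entails T G (Eqn f g)) _ _ _ _ _ _).
- by move=> u v f; exact: entails_basic0 (BRefl V f).
- by move=> u v f g; exact: entails_basic1 (BSym V f g).
- by move=> u v f g h; exact: entails_basic2 (BTrans V f g h).
- by move=> u v w f f' g g'; exact: entails_basic2 (BSeq V f f' g g').
- by move=> u v u' v' f f' g g'; exact: entails_basic2 (BPar V f f' g g').
- by move=> u v f g /(BLaw V); exact: entails_basic0.
Defined.

Local Notation R := entailed_congruence.

(** [smc_eq] is the least congruence, hence finer than provable equality; this lets classes of
    [Term S] be mapped to classes for [R]. *)
Lemma smc_eq_entailed u v (f g : term u v) : smc_eq f g -> cong_rel R f g.
Proof.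
elim=> {u v f g} [u v f g|u v f|u v f g _|u v f g h _ + _
  |u v w f f' g g' _ + _|u v u' v' f f' g g' _ + _];
  [exact: cong_law|exact: cong_refl|exact: cong_sym|exact: cong_trans
  |exact: cong_seq|exact: cong_par].
Qed.

(** Stated on chosen representatives; [entailed_distP] shows that the choice is immaterial. *)
Definition entailed_dist u v (x y : qhom R u v) : V :=
  qsup [set e | entails T G (VEqn e (qrepr x) (qrepr y))].

Lemma entailed_distP u v (f g : term u v) e :
  (e <= entailed_dist (qclass R f) (qclass R g))%O <-> entails T G (VEqn e f g).
Proof.
(* Provable distances are invariant under provable equality, which allows passing between a term and
   the representative of its class. *)
have veqn_cong f' g' h h' e' : cong_rel R f' h -> cong_rel R g' h' ->
    entails T G (VEqn e' f' g') -> @entails d V S T G (@VEqn d V S u v e' h h').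
  move=> f'h g'h' /(entails_basic2 (BEqL _ _ _ _) f'h).
  exact: entails_basic2 (BEqR _ _ _ _) g'h'.
have rf := qrepr_class R f; have rg := qrepr_class R g.
split=> [|Gfg]; last first.
  by apply: qsup_ub; apply: veqn_cong Gfg; exact: cong_sym.
(* By weakening it suffices to prove the bound given by the supremum itself, that is, that the
   supremum is attained. *)
move=> /(BWeak f g) ee'; apply: entails_basic1 ee' _.
apply: veqn_cong rf rg _; rewrite /entailed_dist.
set A := [set _ | _].
(* [BSup] speaks of indexed families, so [A] is indexed by its own elements. *)
have -> : A = range (sval : {e' | A e'} -> V).
  by apply/seteqP; split=> [e' Ae'|_ [[e' Ae'] _ <-]//]; exists (exist _ e' Ae').
apply: entails_rule; first by right; exact: BSup.
by move=> _ [[e' Ae'] _ <-].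
Qed.

Definition entailed_smc : vrel_smc V.
Proof.
refine (@VRelSMC d V (qsmc R) entailed_dist _ _).
- move=> u v w; elim/qhomW=> f; elim/qhomW=> f'.
  elim/qhomW=> g; elim/qhomW=> g' /=; rewrite !qseqE; apply/entailed_distP.
  (* The premises of the rule are the distances themselves, provable by [entailed_distP] at
     reflexivity of the order. *)
  by apply: entails_basic2 (BVSeq _ _ _ _ _ _) _ _; exact/entailed_distP.
- move=> u v u' v'; elim/qhomW=> f; elim/qhomW=> f'.
  elim/qhomW=> g; elim/qhomW=> g' /=; rewrite !qparE; apply/entailed_distP.
  by apply: entails_basic2 (BVPar _ _ _ _ _ _) _ _; exact/entailed_distP.
Defined.

Lemma qclass_entailed u v (f : term u v) :
  qclass R (qrepr (mor_of_term f)) = qclass R f.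
Proof.
apply/qclassP; apply: smc_eq_entailed.
exact: (qrepr_class (smc_congruence S)).
Qed.

(** Identity on objects, so tensors are preserved by [erefl] and the casts vanish by computation. *)
Definition entailed_functor : ssm_functor (Term S) entailed_smc.
Proof.
refine (@SSMFunctor (Term S) entailed_smc id erefl (fun _ _ => erefl)
  (fun u v x => qclass R (qrepr x)) _ _ _ _) => /=.
- by move=> u; exact: qclass_entailed.
- move=> u v w; elim/qhomW=> f; elim/qhomW=> g.
  by rewrite qseqE !qclass_entailed qseqE.
- move=> u v u' v'; elim/qhomW=> f; elim/qhomW=> g.
  by rewrite qparE !qclass_entailed qparE.
- by move=> u v; exact: qclass_entailed.
Defined.

Lemma sat_entailed phi : sat entailed_functor phi <-> entails T G phi.
Proof.
case: phi => [u v f g|u v e f g]; rewrite /sat /interp /= !qclass_entailed.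
  exact: qclassP.
exact: entailed_distP.
Qed.

Definition entailed_model : model T.
Proof.
refine (@Model d V S T entailed_smc entailed_functor _) => -[D phi] TDphi.
apply/sat_implicationP => /= satD; apply/sat_entailed.
(* Premises satisfied in this model are provable from [G], so the axiom itself derives its
   conclusion. *)
by apply: entails_rule (or_introl TDphi) _ => psi /satD /sat_entailed.
Defined.

End Completeness.

Theorem theorem3p8 (d : Order.disp_t) (V : quantaleType d) (S : signature)
    (T : theory V S) (G : set (formula V S)) (phi : formula V S) :
  entails T G phi <->
  forall M : model T, sat_implication (model_fun M) (G ⇒ phi).
Proof.
split=> [Gphi M|satG].
  (* The smallest relation lies in every relation of the required kind, here the implications
     satisfied by [M]. *)
  apply: Gphi; split; first exact: sat_consequence.
  by move=> i [|]; [exact: model_sat|exact: sat_basic].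
have /sat_implicationP /= := satG (entailed_model T G).
move=> satphi; apply/sat_entailed/satphi => psi Gpsi.
by apply/sat_entailed; exact: entails_premise.
Qed.
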